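(* Let $f:\mathbb{R}^d\to\mathbb{R}$ be $\ell$-smooth with $\ell>0$ and let $f(x_0)-\min_{x\in\mathbb{R}^d}f(x)\le\Delta$. Run AMSGrad-norm in the deterministic setting with $\gamma_t=\frac{\gamma}{\sqrt{t+1}}$, $v_0>0$ and $\beta_1=\beta_2=0$, i.e. set $\hat v_0=v_0$ and for $t=0,1,2,\dots$ $$\hat v_{t+1}=\max\{\hat v_t,\|\nabla f(x_t)\|\},\qquad x_{t+1}=x_t-\frac{\gamma}{\sqrt{t+1}\,\hat v_{t+1}}\nabla f(x_t).$$ Then for any $\gamma>0$ and every integer $T\ge1$, $$\frac1T\sum_{t=0}^{T-1}\|\nabla f(x_t)\|\le\begin{cases}\dfrac{\sqrt{2\Delta\max\{v_0,\sqrt{2\ell\Delta}\}}}{\sqrt\gamma\,T^{1/4}}, & \text{when } v_0\ge\gamma\ell,\\[3mm] \dfrac{\gamma^2\ell^2}{v_0\sqrt T}+\dfrac{\sqrt{2(M+\Delta)\max\{\gamma\ell,\sqrt{2\ell(M+\Delta)}\}}}{\sqrt\gamma\,T^{1/4}}, & \text{when } v_0<\gamma\ell,\end{cases}$$ where $M=\ell\gamma^2\left(1+\log\left(\frac{\ell\gamma}{v_0}\right)\right)$.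
   Context: A function $f:\mathbb{R}^d\to\mathbb{R}$ is $\ell$-smooth if it is differentiable and $\|\nabla f(x_1)-\nabla f(x_2)\|\le \ell\|x_1-x_2\|$ for all $x_1,x_2\in\mathbb{R}^d$. ''Deterministic setting'' means exact gradients $\nabla f(x_t)$ are used. $\log$ is the natural logarithm. *)

(* Defs.v *)
From mathcomp Require Import all_boot all_order all_algebra.
From mathcomp Require Import all_classical all_reals all_analysis.

Set Implicit Arguments.
Unset Strict Implicit.
Unset Printing Implicit Defensive.

Import Order.TTheory GRing.Theory Num.Theory.
Import numFieldNormedType.Exports.

Local Open Scope ring_scope.

(* The norm `|x| that the library puts on 'rV[R]_d is the sup norm, hence this
   separate definition.  The two norms are equivalent, so differentiability for
   the library's normed structure is the usual Frechet differentiability. *)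
Definition enorm (R : realType) (d : nat) (x : 'rV[R]_d) : R :=
  Num.sqrt (\sum_(i < d) x ord0 i ^+ 2).

Definition gradient (R : realType) (d : nat) (f : 'rV[R]_d -> R)
    (x : 'rV[R]_d) : 'rV[R]_d :=
  \row_(i < d) 'D_(delta_mx ord0 i) f x.

Definition smooth (R : realType) (d : nat) (l : R) (f : 'rV[R]_d -> R) : Prop :=
  (forall x : 'rV[R]_d, differentiable f x) /\
  (forall x1 x2 : 'rV[R]_d,
     enorm (gradient f x1 - gradient f x2) <= l * enorm (x1 - x2)).

(* Main.v *)
(** Write [F t = f (x t) - f xmin], [g t = |grad f (x t)|] and let [e t] be the
    effective step size, so that smoothness gives
      [F (t+1) <= F t - e t * (g t)^2 + l/2 * (e t)^2 * (g t)^2].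
    Since [1 / e t] is nondecreasing, there is a first time [m] from which
    [l * e t <= 1]; it is [0] when [gamma * l <= v0].  From [m] on, half of
    [e t * (g t)^2] is lost by [F] at each step, so [F] stays bounded by its
    bound [D] up to time [m]; as [(g t)^2 <= 2 * l * F t], this also bounds
    [vhat], hence bounds [e t] from below, and Cauchy-Schwarz bounds the sum of
    [g] after [m].  Before [m], [g t <= vhat m] and [sqrt m * vhat m < gamma * l]
    bound the sum of [g], while [e t * g t <= gamma / sqrt (t+1)] makes [F] grow at
    most like a harmonic sum up to [m <= (gamma * l / v0)^2], whence [M]. *)

Require Import Defs.
From mathcomp Require Import all_boot all_order all_algebra.
From mathcomp Require Import all_classical all_reals all_analysis.
From mathcomp Require Import ring lra.

Set Implicit Arguments.
Unset Strict Implicit.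
Unset Printing Implicit Defensive.

Import Order.TTheory GRing.Theory Num.Theory.
Import numFieldNormedType.Exports.

Local Open Scope ring_scope.

(** * The Euclidean norm and directional derivatives *)

Lemma sqr_enorm (R : realType) (d : nat) (u : 'rV[R]_d) :
  enorm u ^+ 2 = \sum_(i < d) u ord0 i ^+ 2.
Proof. by rewrite sqr_sqrtr// sumr_ge0// => i _; rewrite sqr_ge0. Qed.

Lemma enorm_ge0 (R : realType) (d : nat) (u : 'rV[R]_d) : 0 <= enorm u.
Proof. exact: sqrtr_ge0. Qed.

Lemma enormZ (R : realType) (d : nat) (a : R) (u : 'rV[R]_d) :
  enorm (a *: u) = `|a| * enorm u.
Proof.
rewrite /enorm -sqrtr_sqr -sqrtrM ?sqr_ge0// mulr_sumr.
by congr Num.sqrt; apply: eq_bigr => i _; rewrite mxE exprMn.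
Qed.

Lemma derive_gradient (R : realType) (d : nat) (f : 'rV[R]_d -> R)
    (x h : 'rV[R]_d) : differentiable f x ->
  'D_h f x = \sum_(i < d) h ord0 i * gradient f x ord0 i.
Proof.
move=> df; rewrite deriveE// {1}(row_sum_delta h) linear_sum.
by apply: eq_bigr => i _; rewrite linearZ mxE deriveE.
Qed.

(** The difference quotient along the line at [s] is the very function whose limit defines
    ['D_h f (x + s *: h)], so no chain rule is involved. *)
Lemma is_derive_line (R : realType) (d : nat) (f : 'rV[R]_d -> R)
    (x h : 'rV[R]_d) (s : R) : differentiable f (x + s *: h) ->
  is_derive s 1 (fun t : R => f (x + t *: h)) ('D_h f (x + s *: h)).
Proof.
move=> df; have dfh : derivable f (x + s *: h) h by exact: diff_derivable.
have E : (fun t : R => t^-1 *: (((fun t : R => f (x + t *: h)) \o shift s)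
      (t *: (1 : R)) - f (x + s *: h)))
    = (fun t : R => t^-1 *: ((f \o shift (x + s *: h)) (t *: h)
      - f (x + s *: h))).
  apply/funext => t /=; congr (_ *: (f _ - _)).
  by rewrite [t *: 1]mulr1 scalerDl addrCA.
by apply: DeriveDef; rewrite /derivable/derive E.
Qed.

(* Young's inequality with weight [c] replaces Cauchy-Schwarz here. *)
Lemma dot_le_young (R : realType) (d : nat) (u v : 'rV[R]_d) (c : R) :
  0 < c -> enorm u <= c * enorm v ->
  \sum_(i < d) v ord0 i * u ord0 i <= c * enorm v ^+ 2.
Proof.
move=> c_gt0 uv.
have H : \sum_(i < d) v ord0 i * u ord0 i <=
    (enorm u ^+ 2 / c + c * enorm v ^+ 2) / 2.
  rewrite !sqr_enorm mulr_suml mulr_sumr -big_split/= mulr_suml.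
  apply: ler_sum => i _; rewrite -subr_ge0.
  set a := v _ _; set b := u _ _.
  have -> : (b ^+ 2 / c + c * a ^+ 2) / 2 - a * b = (b - c * a) ^+ 2 / (2 * c).
    by field; rewrite gt_eqF.
  by rewrite divr_ge0 ?sqr_ge0// mulr_ge0// ltW.
apply: (le_trans H).
have : enorm u ^+ 2 / c <= c * enorm v ^+ 2.
  rewrite ler_pdivrMr// mulrAC -expr2 -exprMn.
  by rewrite lerXn2r ?nnegrE ?mulr_ge0 ?enorm_ge0// ltW.
move=> ?; lra.
Qed.

(** * Consequences of smoothness *)

Lemma smooth_descent (R : realType) (d : nat) (l : R) (f : 'rV[R]_d -> R)
    (x h : 'rV[R]_d) : 0 < l -> smooth l f ->
  f (x + h) <= f x + \sum_(i < d) h ord0 i * gradient f x ord0 i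
    + l / 2 * enorm h ^+ 2.
Proof.
move=> l_gt0 [df lip].
set A := \sum_(i < d) _; set B := enorm h ^+ 2.
(* The claim is [phi 1 <= phi 0]. The mean value theorem reduces it to [dphi c <= 0] at one interior
   point, which the Lipschitz bound gives without integrating the gradient. *)
pose phi := (fun t : R => f (x + t *: h)) - (fun t : R => t * A + l / 2 * B * t ^+ 2).
pose dphi (t : R) : R := 'D_h f (x + t *: h) - (A + l * B * t).
have dphiP (t : R) : is_derive t 1 phi (dphi t).
  apply: is_deriveB; first exact: is_derive_line.
  by apply: is_derive_eq; rewrite /GRing.scale/=; field.
have phi_cont : {within `[0, 1], continuous phi}%classic.
  by apply: derivable_within_continuous => s _; case: (dphiP s).
have [c] := MVT ltr01 (fun s _ => dphiP s) phi_cont.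
rewrite in_itv/= => /andP[c_gt0 _].
rewrite subr0 mulr1 /dphi derive_gradient//.
rewrite /phi !fctE scale1r scale0r addr0 => phi_mvt.
suff : \sum_(i < d) h ord0 i * gradient f (x + c *: h) ord0 i - A <= l * c * B.
  by move=> ?; lra.
rewrite /A -sumrB.
have -> : \sum_(i < d) (h ord0 i * gradient f (x + c *: h) ord0 i
      - h ord0 i * gradient f x ord0 i)
    = \sum_(i < d) h ord0 i
        * (gradient f (x + c *: h) - gradient f x) ord0 i.
  by apply: eq_bigr => i _; rewrite !mxE mulrBr.
apply: dot_le_young; first exact: mulr_gt0.
apply: le_trans (lip _ _) _.
by rewrite addrC addKr enormZ gtr0_norm// mulrA.
Qed.

Lemma gradient_step_descent (R : realType) (d : nat) (l : R)
    (f : 'rV[R]_d -> R) (x : 'rV[R]_d) (e : R) : 0 < l -> smooth l f ->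
  f (x - e *: gradient f x) <= f x - e * enorm (gradient f x) ^+ 2
    + l / 2 * e ^+ 2 * enorm (gradient f x) ^+ 2.
Proof.
move=> l_gt0 fs; rewrite -scaleNr.
apply: (le_trans (smooth_descent _ _ l_gt0 fs)).
rewrite enormZ exprMn real_normK ?num_real// sqrrN mulrA lerD2r lerD2l.
rewrite sqr_enorm -mulNr mulr_sumr; apply: ler_sum => i _.
by rewrite mxE -mulrA -expr2.
Qed.

(** A gradient step of size [1 / l] lowers [f] by at least [|grad f x|^2 / (2 * l)], and it cannot
    go below [f xmin]. *)
Lemma sqr_gradient_le (R : realType) (d : nat) (l : R)
    (f : 'rV[R]_d -> R) (x xmin : 'rV[R]_d) : 0 < l -> smooth l f ->
  (forall y, f xmin <= f y) ->
  enorm (gradient f x) ^+ 2 <= 2 * l * (f x - f xmin).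
Proof.
move=> l_gt0 fs xminP.
have := le_trans (xminP _) (gradient_step_descent x l^-1 l_gt0 fs).
set G := _ ^+ 2.
have -> : l / 2 * l^-1 ^+ 2 * G = G / (2 * l) by field; rewrite gt_eqF.
have -> : l^-1 * G = 2 * (G / (2 * l)) by field; rewrite gt_eqF.
move=> H; rewrite mulrC -ler_pdivrMr ?mulr_gt0//; lra.
Qed.

(** * Elementary inequalities for real sums *)

Lemma harmonic_sum_le (R : realType) (n : nat) :
  \sum_(0 <= t < n.+1) (t.+1%:R : R)^-1 <= 1 + ln n.+1%:R.
Proof.
elim: n => [|n IHn]; first by rewrite big_nat1 ln1 addr0 invr1.
rewrite big_nat_recr//=; apply: (le_trans (lerD IHn (lexx _))).
rewrite -addrA lerD2l.
have n1_gt0 : 0 < n.+1%:R :> R by rewrite ltr0n.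
have n2_gt0 : 0 < n.+2%:R :> R by rewrite ltr0n.
(* The increment bound [1 / (n+2) <= ln (n+2) - ln (n+1)] is [ln (1 + y) <= y] at
   [y = - 1 / (n+2)]. *)
have -> : (n.+1%:R : R) = n.+2%:R * (1 + - n.+2%:R^-1).
  by rewrite mulrDr mulr1 mulrN divff ?gt_eqF// -[in RHS]natr1 addrK.
have inv_lt1 : -1 < - n.+2%:R^-1 :> R.
  by rewrite ltrN2 invf_lt1// ltr1n.
rewrite lnM ?posrE//; last by rewrite -ltrBlDl sub0r.
by rewrite -addrA gerDl -lerBrDr sub0r le_ln1Dx.
Qed.

(** Cauchy-Schwarz, from summing [(g t - c)^2 >= 0] and choosing [c = S / T]. The number of terms is
    only bounded by [T], which allows any [m]. *)
Lemma sum_le_of_sum_sqr_le (R : realType) (g : nat -> R) (m T : nat) (A : R) :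
  (0 < T)%N -> 0 <= A ->
  \sum_(m <= t < T) g t ^+ 2 <= T%:R * A ^+ 2 ->
  \sum_(m <= t < T) g t <= T%:R * A.
Proof.
move=> T_gt0 A_ge0 sqr_le; set S := \sum_(m <= t < T) g t.
have T_gt0' : 0 < T%:R :> R by rewrite ltr0n.
have young (c : R) : 2 * c * S <= \sum_(m <= t < T) g t ^+ 2 + T%:R * c ^+ 2.
  have : \sum_(m <= t < T) 2 * c * g t <= \sum_(m <= t < T) (g t ^+ 2 + c ^+ 2).
    apply: ler_sum => t _; rewrite -subr_ge0.
    have -> : g t ^+ 2 + c ^+ 2 - 2 * c * g t = (g t - c) ^+ 2 by ring.
    exact: sqr_ge0.
  rewrite -mulr_sumr big_split/= => /le_trans; apply.
  rewrite lerD2l sumr_const_nat -[leLHS]mulr_natl.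
  by rewrite ler_wpM2r ?sqr_ge0// ler_nat leq_subr.
have := le_trans (young (S / T%:R)) (lerD sqr_le (lexx _)).
have -> : 2 * (S / T%:R) * S = 2 * (S ^+ 2 / T%:R) by ring.
have -> : T%:R * (S / T%:R) ^+ 2 = S ^+ 2 / T%:R by field; rewrite gt_eqF.
move=> H; have : S ^+ 2 / T%:R <= T%:R * A ^+ 2 by lra.
rewrite ler_pdivrMr// => {}H.
case: (lerP 0 S) => [S_ge0|S_lt0]; last first.
  by rewrite (le_trans (ltW S_lt0))// mulr_ge0// ltW.
have TA_ge0 : 0 <= T%:R * A by rewrite mulr_ge0// ltW.
rewrite -(@ler_pXn2r _ 2) ?nnegrE//; apply: (le_trans H).
by rewrite exprMn mulrAC -expr2.
Qed.

Lemma sqr_powR4 (R : realType) (a : R) : 0 <= a ->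
  (a `^ (4^-1)) ^+ 2 = Num.sqrt a.
Proof.
move=> a_ge0; rewrite -powR_mulrn ?powR_ge0// -powRrM.
have -> : (4^-1 * 2%:R : R) = 2^-1 by field.
exact: powR12_sqrt.
Qed.

(** * Running maxima and the sum from [m] on *)

Lemma running_max_ge (R : realType) (g v : nat -> R) (t : nat) :
  (forall t, v t.+1 = Num.max (v t) (g t)) -> v 0%N <= v t.
Proof.
move=> vS; elim: t => [//|t IHt].
by rewrite (le_trans IHt)// vS le_max lexx.
Qed.

Lemma running_max_ge_prev (R : realType) (g v : nat -> R) (t m : nat) :
  (forall t, v t.+1 = Num.max (v t) (g t)) -> (t < m)%N -> g t <= v m.
Proof.
move=> vS; elim: m => [//|m IHm]; rewrite ltnS leq_eqVlt vS le_max.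
by move=> /orP[/eqP ->|/IHm ->//]; rewrite lexx orbT.
Qed.

(** Serves both cases of the theorem: [m = 0], [W = v 0], [D = Delta] for large [v 0], and
    [W = gamma * l], [D = M + Delta] otherwise. *)
Lemma tail_mean_le (R : realType) (F g v : nat -> R) (l gamma D W : R)
    (m T : nat) :
  0 < l -> 0 < gamma -> (0 < T)%N ->
  (forall t, 0 <= F t) ->
  (forall t, 0 <= g t) ->
  (forall t, g t ^+ 2 <= 2 * l * F t) ->
  (forall t, v t.+1 = Num.max (v t) (g t)) ->
  0 < v 0%N -> v 0%N <= W ->
  (forall t, let e := gamma / (Num.sqrt t.+1%:R * v t.+1) in
     F t.+1 <= F t - e * g t ^+ 2 + l / 2 * e ^+ 2 * g t ^+ 2) ->
  (forall t, (t <= m)%N -> F t <= D) ->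
  (forall t, (m <= t)%N -> gamma * l <= Num.sqrt t.+1%:R * v t.+1) ->
  T%:R^-1 * \sum_(m <= t < T) g t <=
    Num.sqrt (2 * D * Num.max W (Num.sqrt (2 * l * D))) /
      (Num.sqrt gamma * T%:R `^ (4^-1)).
Proof.
move=> l_gt0 gamma_gt0 T_gt0 F_ge0 g_ge0 gF vS v0_gt0 v0W descent F_head l_step.
set V := Num.max W _; set A := _ / _.
have T_gt0' : 0 < T%:R :> R by rewrite ltr0n.
pose e t := gamma / (Num.sqrt t.+1%:R * v t.+1).
have v_gt0 t : 0 < v t by exact: lt_le_trans (running_max_ge t vS).
have sv_gt0 t : 0 < Num.sqrt t.+1%:R * v t.+1.
  by rewrite mulr_gt0 ?sqrtr_gt0 ?ltr0n.
have D_ge0 : 0 <= D by exact: le_trans (F_ge0 m) (F_head m (leqnn m)).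
(* Used twice: dropping the sum bounds [F] after [m], and dropping [F] bounds the weighted sum of
   squares. *)
have telescope n :
    F (m + n)%N + \sum_(m <= t < m + n) e t * g t ^+ 2 / 2 <= F m.
  elim: n => [|n IHn]; first by rewrite addn0 big_geq// addr0.
  rewrite addnS big_nat_recr ?leq_addr//=.
  have := descent (m + n)%N; rewrite /= -/(e _) => {}descent.
  apply: le_trans IHn; set t := (m + n)%N in descent *.
  have : l * e t <= 1.
    by rewrite /e mulrA ler_pdivrMr ?sv_gt0// mul1r mulrC l_step ?leq_addr.
  have e_ge0 : 0 <= e t by rewrite ltW ?divr_gt0.
  have := mulr_ge0 e_ge0 (sqr_ge0 (g t)).
  set G := g t ^+ 2 in descent *; move=> eG_ge0 le1.
  have : l / 2 * e t ^+ 2 * G <= e t * G / 2.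
    have -> : l / 2 * e t ^+ 2 * G = (l * e t) * (e t * G / 2) by field.
    by rewrite ler_piMl// divr_ge0.
  by move=> ?; lra.
have summand_ge0 t : 0 <= e t * g t ^+ 2 / 2.
  by rewrite divr_ge0// mulr_ge0 ?sqr_ge0// ltW ?divr_gt0.
have F_le t : F t <= D.
  have [/F_head //|/ltnW mt] := leqP t m.
  have := telescope (t - m)%N; rewrite subnKC// => tel.
  apply: le_trans (F_head m (leqnn m)); apply: le_trans tel.
  by rewrite lerDl; apply: sumr_ge0.
have g_le t : g t <= Num.sqrt (2 * l * D).
  rewrite -[g t]ger0_norm// -sqrtr_sqr ler_wsqrtr//.
  by apply: (le_trans (gF t)); rewrite ler_wpM2l// mulr_ge0// ltW.
have v_le t : v t <= V.
  elim: t => [|t IHt]; first by rewrite le_max v0W.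
  by rewrite vS ge_max IHt/= le_max g_le orbT.
have V_gt0 : 0 < V by exact: lt_le_trans (v_le 0%N).
have VD_ge0 : 0 <= 2 * D * V by rewrite !mulr_ge0// ltW.
rewrite mulrC ler_pdivrMr// [leRHS]mulrC.
apply: sum_le_of_sum_sqr_le => //; first by rewrite divr_ge0// mulr_ge0// powR_ge0.
have sT_gt0 : 0 < Num.sqrt T%:R :> R by rewrite sqrtr_gt0.
(* The factor [sqrt T * V / gamma] is the inverse of the lower bound for [e t] when [t < T], used
   below; its [sqrt T] is what leaves [T^(1/4)] in [A]. *)
have -> : T%:R * A ^+ 2 = 2 * D * (Num.sqrt T%:R * V / gamma).
  rewrite expr_div_n exprMn !sqr_sqrtr ?(ltW gamma_gt0)// sqr_powR4//.
  rewrite -{1}(@sqr_sqrtr _ T%:R)//.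
  by field; rewrite !gt_eqF.
have [mT|Tm] := leqP m T; last first.
  rewrite big_geq ?(ltnW Tm)//; apply: mulr_ge0; first exact: mulr_ge0.
  by rewrite divr_ge0// ?(ltW gamma_gt0)// mulr_ge0// ltW.
have : \sum_(m <= t < T) e t * g t ^+ 2 / 2 <= D.
  apply: le_trans (F_head m (leqnn m)).
  by have := telescope (T - m)%N; rewrite subnKC//; apply: le_trans; rewrite lerDr.
rewrite -mulr_suml ler_pdivrMr// mulrC => sum_e.
have : \sum_(m <= t < T) gamma / (Num.sqrt T%:R * V) * g t ^+ 2 <= 2 * D.
  apply: le_trans sum_e; rewrite !big_nat; apply: ler_sum => t /andP[_ tT].
  rewrite ler_wpM2r ?sqr_ge0// ler_pM2l// lef_pV2 ?posrE ?mulr_gt0//.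
  by rewrite ler_pM ?(ltW (v_gt0 _))// ler_wsqrtr// ler_nat.
rewrite -mulr_sumr mulrC -ler_pdivlMr ?divr_gt0 ?mulr_gt0//.
by rewrite invf_div.
Qed.

(** * The steps before [m] *)

Lemma head_sum_le (R : realType) (g v : nat -> R) (a : R) (m : nat) :
  0 <= a ->
  (forall t, v t.+1 = Num.max (v t) (g t)) -> 0 < v 0%N ->
  (forall t, (t < m)%N -> Num.sqrt t.+1%:R * v t.+1 < a) ->
  \sum_(0 <= t < m) g t <= a ^+ 2 / v 0%N.
Proof.
move=> a_ge0 vS v0_gt0 head; case: m head => [|m] head.
  by rewrite big_geq// divr_ge0 ?sqr_ge0// ltW.
have := head m (ltnSn m); set n := m.+1 => head_n.
have v0n : v 0%N <= v n by exact: running_max_ge.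
have vn_ge0 : 0 <= v n by rewrite (le_trans _ v0n)// ltW.
have : \sum_(0 <= t < n) g t <= \sum_(0 <= t < n) v n.
  by rewrite !big_nat; apply: ler_sum => t /andP[_ tn]; exact: running_max_ge_prev.
move=> /le_trans; apply.
rewrite sumr_const_nat subn0 -[leLHS]mulr_natl ler_pdivlMr//.
rewrite -(@sqr_sqrtr _ n%:R)//; set s := Num.sqrt _ in head_n *.
have s_ge0 : 0 <= s by exact: sqrtr_ge0.
(* Splitting [n] as [s * s] lets the bound at the last index [n - 1] be used twice, the second time
   through [v 0 <= v n]. *)
have -> : s ^+ 2 * v n * v 0%N = (s * v n) * (s * v 0%N) by ring.
have sv0_le : s * v 0%N <= a by rewrite (le_trans _ (ltW head_n))// ler_wpM2l.
apply: ler_pM => //; [exact: mulr_ge0 | | exact: ltW].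
by rewrite mulr_ge0// ltW.
Qed.

(** As [g t <= v (t+1)], step [t] raises [F] by at most [l * gamma^2 / (2 * (t+1))], however large
    the gradient is. *)
Lemma head_gap_le (R : realType) (F g v : nat -> R) (l gamma D : R) (m : nat) :
  0 < l -> 0 < gamma ->
  (forall t, 0 <= g t) ->
  (forall t, v t.+1 = Num.max (v t) (g t)) ->
  0 < v 0%N -> v 0%N <= gamma * l ->
  (forall t, let e := gamma / (Num.sqrt t.+1%:R * v t.+1) in
     F t.+1 <= F t - e * g t ^+ 2 + l / 2 * e ^+ 2 * g t ^+ 2) ->
  F 0%N <= D ->
  (forall t, (t < m)%N -> Num.sqrt t.+1%:R * v t.+1 < gamma * l) ->
  forall t, (t <= m)%N ->
    F t <= l * gamma ^+ 2 * (1 + ln (l * gamma / v 0%N)) + D.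
Proof.
move=> l_gt0 gamma_gt0 g_ge0 vS v0_gt0 v0_le descent F0 head.
have v_gt0 t : 0 < v t by exact: lt_le_trans (running_max_ge t vS).
have growth t : F t <= F 0%N + l * gamma ^+ 2 / 2 * \sum_(0 <= s < t) s.+1%:R^-1.
  elim: t => [|t IHt]; first by rewrite big_geq// mulr0 addr0.
  rewrite big_nat_recr//= mulrDr addrA; apply: (le_trans (descent t)) => /=.
  set e := gamma / _; have e_ge0 : 0 <= e.
    by rewrite divr_ge0 ?mulr_ge0// ?ltW.
  apply: lerD.
    by apply: le_trans IHt; rewrite gerBl mulr_ge0 ?sqr_ge0.
  have -> : l / 2 * e ^+ 2 * g t ^+ 2
      = l * gamma ^+ 2 / 2 / t.+1%:R * (g t / v t.+1) ^+ 2.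
    rewrite /e expr_div_n exprMn sqr_sqrtr//.
    by field; rewrite gt_eqF//= pnatr_eq0.
  rewrite ler_piMr//; first by rewrite !divr_ge0// mulr_ge0 ?sqr_ge0// ltW.
  rewrite expr_le1// ?ler_pdivrMr ?mul1r ?divr_ge0// ?(ltW (v_gt0 _))//.
  exact: running_max_ge_prev.
set x := l * gamma / v 0%N.
have x_ge1 : 1 <= x by rewrite ler_pdivlMr// mul1r mulrC.
have lnx_ge0 : 0 <= ln x by exact: ln_ge0.
have c_ge0 : 0 <= l * gamma ^+ 2 by rewrite mulr_ge0 ?sqr_ge0// ltW.
(* At time [0] there is no harmonic sum, and only nonnegativity of the added term matters. *)
case=> [_|t tm].
  by rewrite (le_trans F0)// lerDr mulr_ge0// addr_ge0.
apply: (le_trans (growth _)); rewrite addrC lerD//.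
rewrite -mulrA ler_wpM2l//.
have x_gt0 : 0 < x by exact: lt_le_trans x_ge1.
(* Before [m], [sqrt (t+1) * v 0 < gamma * l], that is [t+1 < x^2]. The factor [2] cancels the [1/2]
   of the growth bound. *)
have ln_le : ln t.+1%:R <= 2 * ln x.
  rewrite mulr_natl -lnXn// ler_ln ?posrE ?exprn_gt0//.
  rewrite -(@sqr_sqrtr _ t.+1%:R)// ler_pXn2r ?nnegrE ?sqrtr_ge0 ?(ltW x_gt0)//.
  rewrite ler_pdivlMr// [leRHS]mulrC; apply: le_trans (ltW (head t tm)).
  by rewrite ler_wpM2l ?sqrtr_ge0//; exact: running_max_ge.
rewrite mulrC ler_pdivrMr//; apply: le_trans (harmonic_sum_le R t) _.
by rewrite mulrDl mul1r lerD// ?ler1n// mulrC.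
Qed.

(** * Combination of the two ranges *)

Theorem theorem5 (R : realType) (d : nat) (f : 'rV[R]_d -> R)
    (l Delta gamma v0 : R) (xmin : 'rV[R]_d)
    (x : nat -> 'rV[R]_d) (vhat : nat -> R)
    (l_gt0 : 0 < l)
    (f_smooth : smooth l f)
    (xmin_min : forall y : 'rV[R]_d, f xmin <= f y)
    (f_gap : f (x 0%N) - f xmin <= Delta)
    (gamma_gt0 : 0 < gamma)
    (v0_gt0 : 0 < v0)
    (vhat_init : vhat 0%N = v0)
    (vhat_step : forall t : nat,
       vhat t.+1 = Num.max (vhat t) (enorm (gradient f (x t))))
    (x_step : forall t : nat,
       x t.+1 = x t -
         (gamma / (Num.sqrt t.+1%:R * vhat t.+1)) *: gradient f (x t))
    (T : nat) (T_ge1 : (1 <= T)%N) :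
  let M := l * gamma ^+ 2 * (1 + ln (l * gamma / v0)) in
  T%:R^-1 * \sum_(0 <= t < T) enorm (gradient f (x t)) <=
  if gamma * l <= v0 then
    Num.sqrt (2 * Delta * Num.max v0 (Num.sqrt (2 * l * Delta))) /
      (Num.sqrt gamma * T%:R `^ (4^-1))
  else
    gamma ^+ 2 * l ^+ 2 / (v0 * Num.sqrt T%:R) +
    Num.sqrt (2 * (M + Delta) *
              Num.max (gamma * l) (Num.sqrt (2 * l * (M + Delta)))) /
      (Num.sqrt gamma * T%:R `^ (4^-1)).
Proof.
cbv zeta; subst v0.
pose F t := f (x t) - f xmin; pose g t := enorm (gradient f (x t)).
have F_ge0 t : 0 <= F t by rewrite subr_ge0.
have g_ge0 t : 0 <= g t by exact: enorm_ge0.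
have gF t : g t ^+ 2 <= 2 * l * F t by exact: sqr_gradient_le.
have descent t : let e := gamma / (Num.sqrt t.+1%:R * vhat t.+1) in
    F t.+1 <= F t - e * g t ^+ 2 + l / 2 * e ^+ 2 * g t ^+ 2.
  move=> e; rewrite /F x_step -/e.
  have := gradient_step_descent (x t) e l_gt0 f_smooth.
  by rewrite -/(g t); lra.
have vS : forall t, vhat t.+1 = Num.max (vhat t) (g t) by [].
pose sv t := Num.sqrt t.+1%:R * vhat t.+1.
have sv_ge t n : (n <= t.+1)%N -> Num.sqrt n%:R * vhat 0%N <= sv t.
  move=> nt; apply: ler_pM; rewrite ?sqrtr_ge0 ?(ltW v0_gt0)//.
    by rewrite ler_wsqrtr// ler_nat.
  exact: running_max_ge.
have [large|small] := boolP (gamma * l <= vhat 0%N).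
  apply: (@tail_mean_le R F g vhat l gamma Delta (vhat 0%N) 0 T) => //.
    by move=> t; rewrite leqn0 => /eqP ->.
  move=> t _; apply: (le_trans large).
  by have := sv_ge t 1%N isT; rewrite sqrtr1 mul1r.
rewrite -ltNge in small.
(* Since [sv t >= sqrt t * vhat 0], any integer above [(gamma * l / vhat 0)^2] is a witness. *)
have ex_large : exists t, gamma * l <= sv t.
  set r := gamma * l / vhat 0%N.
  have r_ge0 : 0 <= r by rewrite divr_ge0 ?mulr_ge0// ltW.
  exists (Num.bound (r ^+ 2)); apply: le_trans (sv_ge _ _ (leqnSn _)).
  rewrite -ler_pdivrMr// -/r -[leLHS]ger0_norm// -sqrtr_sqr ler_wsqrtr//.
  exact/ltW/archi_boundP/sqr_ge0.
case: (ex_minnP ex_large) => m m_large m_min.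
have head t : (t < m)%N -> sv t < gamma * l.
  by move=> tm; rewrite ltNge; apply/negP => /m_min; rewrite leqNgt tm.
have tail t : (m <= t)%N -> gamma * l <= sv t.
  elim: t => [|t IHt]; first by rewrite leqn0 => /eqP <-.
  rewrite leq_eqVlt ltnS => /orP[/eqP <- //|/IHt /le_trans]; apply.
  apply: ler_pM; rewrite ?sqrtr_ge0//.
  - by rewrite (le_trans (ltW v0_gt0))//; exact: running_max_ge.
  - by rewrite ler_wsqrtr// ler_nat.
  - by rewrite [leRHS]vS le_max lexx.
have F_head := head_gap_le l_gt0 gamma_gt0 g_ge0 vS v0_gt0 (ltW small) descent
  f_gap head.
have T_gt0 : 0 < T%:R :> R by rewrite ltr0n.
(* Only an inequality, since [T] may be smaller than [m]; the first sum then has extra nonnegative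
   terms. *)
have split_sum : \sum_(0 <= t < T) g t
    <= \sum_(0 <= t < m) g t + \sum_(m <= t < T) g t.
  have [mT|Tm] := leqP m T; first by rewrite -big_cat_nat.
  rewrite (big_cat_nat _ (ltnW Tm))//= [leRHS]addrC addrCA lerDl.
  by rewrite addr_ge0// sumr_ge0.
apply: (@le_trans _ _ (T%:R^-1 * (\sum_(0 <= t < m) g t + \sum_(m <= t < T) g t))).
  by rewrite ler_wpM2l// invr_ge0 ltW.
rewrite mulrDr lerD//; last first.
  exact: (tail_mean_le l_gt0 gamma_gt0 T_ge1 F_ge0 g_ge0 gF vS v0_gt0 (ltW small)
    descent F_head tail).
have gl_ge0 : 0 <= gamma * l by rewrite mulr_ge0// ltW.
have := head_sum_le gl_ge0 vS v0_gt0 head; rewrite exprMn.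
set a := gamma ^+ 2 * l ^+ 2; set S := \sum_(0 <= t < m) _ => S_le.
have sT_gt0 : 0 < Num.sqrt T%:R :> R by rewrite sqrtr_gt0.
(* The first sum contributes a term of order [1 / T], weakened to the stated [1 / sqrt T] by
   [T >= 1]. *)
rewrite invfM mulrA mulrC ler_pM ?invr_ge0 ?sumr_ge0 ?(ltW T_gt0)//.
rewrite lef_pV2 ?posrE// -{2}(@sqr_sqrtr _ T%:R) ?(ltW T_gt0)// expr2.
by rewrite ler_peMl ?sqrtr_ge0// -[leLHS]sqrtr1 ler_wsqrtr// ler1n.
Qed.
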